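(* For every integer $k\ge 2$, the set $F_k$ is finite.
   Context: For $r\ge 2$, a $p$-step chain of length $r$ in $[0,1]$ is a sequence $[y_0,y_1,\dots,y_r]\subset[0,1]$ with $y_i-y_{i-1}=p$ for $i=1,\dots,r$; $y_0,y_r$ are its extreme points and the $y_i$ with $0<i<r$ are its interior points. The set $F_k\subset[0,1]$ is the set generated by the following recursive procedure (a priori possibly non-terminating). Start with $H=\{0,1\}$, where $0$ and $1$ carry the value $0$. Whenever $y_1<y_2$ are in $H$, $r\ge 2$ is an integer, $p=\frac{y_2-y_1}{r}\ge\frac1k$, and $p$ is strictly larger than the (smallest) values currently carried by $y_1$ and by $y_2$, add to $H$ all interior points $y_1+jp$ ($1\le j\le r-1$) of the $p$-step chain with extreme points $y_1,y_2$; each such interior point carries the value $p$ (the smallest such $p$, if it arises several times). Repeat as long as possible; $F_k$ is the set of all numbers so obtained. Equivalently: let $R$ be the smallest set of pairs of real numbers such that $(0,0),(1,0)\in R$ and, whenever $(y_1,q_1),(y_2,q_2)\in R$, $y_1<y_2$, $r\ge2$ is an integer, $p=\frac{y_2-y_1}{r}\ge\frac1k$ and $p>\max\{q_1,q_2\}$, then $(y_1+jp,\,p)\in R$ for $j=1,\dots,r-1$; then $F_k=\{y : (y,q)\in R \text{ for some } q\}$. For example $F_2=\{0,\frac12,1\}$ and $F_3=\{0,\frac13,\frac12,\frac23,1\}$. *)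

(* Defs.v *)
From mathcomp Require Import all_boot all_order all_algebra.
From mathcomp Require Import all_classical all_reals.

Set Implicit Arguments.
Unset Strict Implicit.
Unset Printing Implicit Defensive.

Import Order.TTheory GRing.Theory Num.Theory.

Local Open Scope ring_scope.
Local Open Scope classical_set_scope.

(* [carries k y q] : at some stage of the procedure the point y carries the
   value q, i.e. (y, q) belongs to the least set of pairs closed under chain
   insertion.  A point may carry several values: a pair is never removed when
   a smaller value is found later. *)
Inductive carries (R : realType) (k : nat) : R -> R -> Prop :=
| carries0 : carries k 0 0
| carries1 : carries k 1 0
| carries_interior (y1 q1 y2 q2 p : R) (r j : nat) :
    carries k y1 q1 -> carries k y2 q2 -> y1 < y2 ->
    (2 <= r)%N -> p = (y2 - y1) / r%:R ->
    1 / k%:R <= p -> Num.max q1 q2 < p ->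
    (1 <= j <= r.-1)%N ->
    carries k (y1 + j%:R * p) p.

Definition chain_set (R : realType) (k : nat) : set R :=
  [set y | exists q : R, carries k y q].

Arguments chain_set : clear implicits.

(* Main.v *)
Require Import Defs.
From mathcomp Require Import all_boot all_order all_algebra.
From mathcomp Require Import all_classical all_reals.
From mathcomp Require Import ring lra.

(* Only finitely many pairs have value [<= u] once finitely many have value
   [< u], so it suffices to show that the values do not accumulate from below at
   the first possible accumulation point [t].  Suppose they do.  From a point
   with value close to [t], pass repeatedly to the left end of the chain creating
   it until a value [<= t - e] is met at a point [a], and likewise to the right
   until a point [b]: then [b - a] is slightly less than a multiple [m * t].
   There are only finitely many such points for a given [e], so if moreover all
   the values passed are [> t - e'] with [e'] much smaller than [e], this is
   impossible.  Hence the bracket from [a] to [b] gets wider, by at least [1 / k],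
   each time [e] is raised from a level to a much larger one; using more than [k]
   levels, it does not fit in [0, 1]. *)

Set Implicit Arguments.
Unset Strict Implicit.
Unset Printing Implicit Defensive.

Import Order.TTheory GRing.Theory Num.Theory.

Local Open Scope ring_scope.
Local Open Scope classical_set_scope.

(** * Finite sets of reals and finite images *)

Lemma finite_set_pos_lb (R : realType) (A : set R) : finite_set A ->
  exists2 e : R, 0 < e & forall x, A x -> 0 < x -> e <= x.
Proof.
move=> /finite_seqP[s ->]; elim: s => [|a s [e e0 es]].
  by exists 1 => // x /=; rewrite in_nil.
have [a0|a0] := ltP 0 a.
- exists (Num.min a e); first by rewrite lt_min a0.
  move=> x /=; rewrite inE ge_min => /orP[/eqP ->|xs] x0; first by rewrite lexx.
  by rewrite es ?orbT.
- exists e => // x /=; rewrite inE => /orP[/eqP ->|xs] x0; last exact: es.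
  by move: (le_lt_trans a0 x0); rewrite ltxx.
Qed.

Lemma finite_image_pairs_ord (T U : Type) (A : set T) (n : nat) (f : T -> T -> nat -> U) :
  finite_set A ->
  finite_set [set f z.1.1 z.1.2 z.2 | z in A `*` A `*` `I_n].
Proof. by move=> fA; apply/finite_image/finite_setX => //; exact: finite_setX. Qed.

(** * Chains and the points they create *)

Section Chains.
Variables (R : realType) (k : nat).
Hypothesis k_gt0 : (0 < k)%N.

Let k0 : 0 < k%:R :> R. Proof. by rewrite ltr0n. Qed.

Definition below (u : R) : set (R * R) := [set x | carries k x.1 x.2 /\ x.2 < u].

(** Stating the chain condition without division leaves later goals to linear arithmetic. *)
Lemma carries_chain_ind (P : R -> R -> Prop) :
  P 0 0 -> P 1 0 ->
  (forall y1 q1 y2 q2 q (r j : nat),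
    carries k y1 q1 -> P y1 q1 -> carries k y2 q2 -> P y2 q2 ->
    y2 = y1 + r%:R * q -> q1 < q -> q2 < q -> 1 <= k%:R * q ->
    (0 < j)%N -> (j < r)%N -> P (y1 + j%:R * q) q) ->
  forall y q, carries k y q -> P y q.
Proof.
move=> P0 P1 PS y q; elim=> //.
move=> y1 q1 y2 q2 p r j c1 H1 c2 H2 y12 r2 pE kp mp /andP[j1 jr].
have r0 : (0 < r)%N by exact: leq_trans r2.
move: mp; rewrite gt_max => /andP[q1p q2p].
apply: (PS y1 q1 y2 q2 p r j) => //.
- by rewrite pE mulrC divfK ?subrKC// pnatr_eq0 -lt0n.
- by rewrite mulrC -ler_pdivrMr.
- by rewrite -(prednK r0) ltnS.
Qed.

Lemma carries_inv (y q : R) : carries k y q ->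
  q = 0 /\ (y = 0 \/ y = 1) \/
  exists y1 q1 y2 q2 (r j : nat),
    [/\ carries k y1 q1, carries k y2 q2 & [/\ y2 = y1 + r%:R * q, y = y1 + j%:R * q,
     q1 < q, q2 < q & [/\ 1 <= k%:R * q, (0 < j)%N & (j < r)%N]]].
Proof.
move: y q; apply: carries_chain_ind; [by left; split=> //; left|by left; split=> //; right|].
move=> y1 q1 y2 q2 q r j c1 _ c2 _ y2E q1q q2q kq j0 jr.
by right; exists y1, q1, y2, q2, r, j.
Qed.

Lemma carries_itv (y q : R) : carries k y q -> 0 <= y <= 1.
Proof.
move: y q; apply: carries_chain_ind; [by rewrite lexx ler01|by rewrite lexx ler01|].
move=> y1 q1 y2 q2 q r j _ /andP[y10 y11] _ /andP[_ y21] y2E _ _ kq j0 jr.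
have q0 : 0 < q by rewrite -(pmulr_rgt0 _ k0); lra.
have jq : 0 <= j%:R * q by rewrite mulr_ge0// ltW.
have : j%:R * q <= r%:R * q by apply: ler_wpM2r; [exact: ltW|rewrite ler_nat ltnW].
by move=> ?; apply/andP; split; lra.
Qed.

Lemma chain_length_le (y1 q1 y2 q2 q : R) (r : nat) :
  carries k y1 q1 -> carries k y2 q2 -> y2 = y1 + r%:R * q -> 1 <= k%:R * q ->
  (r <= k)%N.
Proof.
move=> /carries_itv/andP[? _] /carries_itv/andP[_ ?] y2E kq.
have rq1 : r%:R * q <= 1 by lra.
have q0 : 0 < q by rewrite -(pmulr_rgt0 _ k0); lra.
by rewrite -(ler_nat R) -(ler_pM2r q0); lra.
Qed.

(** * Finiteness up to a threshold and slightly beyond *)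

Lemma finite_below0 : finite_set (below k%:R^-1).
Proof.
apply: (@sub_finite_set _ _ [set (0, 0); (1, 0)]); last exact: finite_set2.
move=> [y q] [/= /carries_inv[[-> [->|->]] _|]]; [by left|by right|].
move=> [? [? [? [? [? [? [_ _ [_ _ _ _ [kq _ _]]]]]]]]].
by rewrite -[_^-1]mul1r ltr_pdivlMr// mulrC ltNge kq.
Qed.

(** A created pair is determined by its two parents, whose values are strictly smaller, and by
    [r <= k] and [j < r]. *)
Lemma finite_closed (u : R) : finite_set (below u) ->
  finite_set [set x | carries k x.1 x.2 /\ x.2 <= u].
Proof.
move=> fu.
pose f (a : R) (x1 x2 : R * R) (r : nat) := (x1.1 + a * ((x2.1 - x1.1) / r%:R),
  (x2.1 - x1.1) / r%:R).
apply: (@sub_finite_set _ _ ([set (0, 0); (1, 0)] `|`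
   \bigcup_(j in `I_k) [set f j%:R z.1.1 z.1.2 z.2 | z in below u `*` below u `*` `I_k.+1])).
  move=> [y q] [/= /carries_inv[[-> [->|->]] _|]]; [by left; left|by left; right|].
  move=> [y1 [q1 [y2 [q2 [r [j [c1 c2 [y2E yE q1q q2q [kq j0 jr]]]]]]]]] qu.
  have rk := chain_length_le c1 c2 y2E kq.
  right; exists j; first exact: leq_trans jr rk.
  exists ((y1, q1), (y2, q2), r).
    by split=> //=; split; split=> //=; exact: lt_le_trans qu.
  rewrite /f /=.
  have -> : (y2 - y1) / r%:R = q.
    by rewrite y2E addrAC subrr add0r mulrC mulKf// pnatr_eq0 -lt0n (leq_trans _ jr).
  by rewrite yE.
rewrite finite_setU; split; first exact: finite_set2.
by apply: bigcup_finite => // j _; exact: finite_image_pairs_ord.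
Qed.

(** A value above [u] whose parents carry at most [u] is one of finitely many quotients, so it
    exceeds [u] by some uniform [e]; descendants of such points carry even more. *)
Lemma finite_gap (u : R) : finite_set (below u) ->
  exists2 e, 0 < e & finite_set (below (u + e)).
Proof.
move=> /finite_closed fu.
have [e e0 he] := finite_set_pos_lb
  (finite_image_pairs_ord k.+1 (fun x1 x2 r => (x2.1 - x1.1) / r%:R - u) fu).
have gap y q : carries k y q -> 0 < u -> q <= u \/ u + e <= q.
  move=> + u0; move: y q; apply: carries_chain_ind; [by left; lra|by left; lra|].
  move=> y1 q1 y2 q2 q r j c1 H1 c2 H2 y2E q1q q2q kq j0 jr.
  have [|uq] := leP q u; first by left.
  right.
  case: H1 => H1; last by lra.
  case: H2 => H2; last by lra.
  have qE : (y2 - y1) / r%:R = q.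
    by rewrite y2E addrAC subrr add0r mulrC mulKf// pnatr_eq0 -lt0n (leq_trans _ jr).
  suff : e <= q - u by lra.
  apply: he; last by lra.
  exists ((y1, q1), (y2, q2), r); last by rewrite /= qE.
  split=> //=; apply: (chain_length_le c1 c2 y2E kq).
have [u0|u0] := ltP 0 u.
  exists e => //; apply: sub_finite_set fu => -[y q] [/= c qu]; split=> //=.
  by have [|] := gap _ _ c u0 => //; lra.
(* For [u <= 0], [u + 1 / k] does not exceed [1 / k], below which only the starting pairs occur. *)
exists k%:R^-1; first by rewrite invr_gt0.
by apply: sub_finite_set finite_below0 => -[y q] [/= c qu]; split=> //=; lra.
Qed.

(** * Excluding accumulation of values from below *)

Section Accumulation.
Variable t : R.
Hypothesis finite_belowt : forall u, u < t -> finite_set (below u).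
Hypothesis accum : forall e, 0 < e -> exists y q, carries k y q /\ t - e < q < t.

(* Satisfied when [b - a] is a sum of [m > 0] values, each in ]t - e, t[ and at
   least [1 / k]. *)
Definition near_multiple (e a b : R) (m : nat) : Prop :=
  [/\ 0 < m%:R * t - (b - a), m%:R * t - (b - a) <= m%:R * e &
      m%:R <= k%:R * (b - a)].

Lemma near_multipleD e a b c m n :
  near_multiple e a b m -> near_multiple e b c n -> near_multiple e a c (m + n).
Proof.
by move=> [h1 h2 h3] [h4 h5 h6]; split; rewrite natrD; lra.
Qed.

Lemma near_multiple_le e e' a b m :
  e' <= e -> near_multiple e' a b m -> near_multiple e a b m.
Proof.
move=> ee' [h1 h2 h3]; split=> //; apply: le_trans h2 _.
by rewrite ler_wpM2l.
Qed.

Lemma near_multiple_gt0 e a b m : near_multiple e a b m -> (0 < m)%N.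
Proof.
move=> [h1 h2 h3]; rewrite lt0n; apply/eqP => m0; move: h1 h2 h3; rewrite m0; lra.
Qed.

Lemma near_multiple_step e a q j : (0 < j)%N -> t - e < q < t -> 1 <= k%:R * q ->
  near_multiple e a (a + j%:R * q) j.
Proof.
move=> j0 /andP[tq qt] kq; have j0' : 0 < j%:R :> R by rewrite ltr0n.
rewrite /near_multiple addrAC subrr add0r -mulrBr; split.
- by rewrite mulr_gt0// subr_gt0.
- by rewrite ler_pM2l//; lra.
- by rewrite mulrCA ler_peMr// ltW.
Qed.

(** Parents carry smaller values, so a parent either stops the descent or still has its value in []t
    - e, t[]; the near multiples traversed add up. *)
Lemma ancestors e y q : e <= t -> carries k y q -> t - e < q < t ->
  (exists a qa m, [/\ carries k a qa, qa <= t - e & near_multiple e a y m]) /\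
  (exists b qb m, [/\ carries k b qb, qb <= t - e & near_multiple e y b m]).
Proof.
(* Starting pairs are vacuous: [e <= t] rules out [t - e < 0]. *)
move=> et; move: y q; apply: carries_chain_ind; [by lra|by lra|].
move=> y1 q1 y2 q2 q r j c1 H1 c2 H2 y2E q1q q2q kq j0 jr tqt.
have /andP[_ qt] := tqt; split.
- have st := near_multiple_step y1 j0 tqt kq.
  have [q1t|q1t] := leP q1 (t - e); first by exists y1, q1, j.
  have /H1[[a [qa [m [ca qae nm]]]] _] : t - e < q1 < t.
    by rewrite q1t (lt_trans q1q).
  by exists a, qa, (m + j)%N; split=> //; exact: near_multipleD nm st.
- have rj0 : (0 < r - j)%N by rewrite subn_gt0.
  have st := near_multiple_step (y1 + j%:R * q) rj0 tqt kq.
  have y2E' : y1 + j%:R * q + (r - j)%:R * q = y2.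
    by rewrite y2E natrB 1?ltnW//; ring.
  rewrite y2E' in st.
  have [q2t|q2t] := leP q2 (t - e); first by exists y2, q2, (r - j)%N.
  have /H2[_ [b [qb [m [cb qbe nm]]]]] : t - e < q2 < t.
    by rewrite q2t (lt_trans q2q).
  by exists b, qb, (r - j + m)%N; split=> //; exact: near_multipleD st nm.
Qed.

(* For [e'] small against [e], the distance between two points carrying at most
   [t - e] falls short of [m * t] by more than [m * e'], so a bracket at level
   [e'] has to be enlarged at one of its ends to become a bracket at level [e]. *)
Lemma wide_bracket (n : nat) e : 0 < e <= t ->
  exists a qa b qb m, [/\ carries k a qa /\ qa <= t - e,
    carries k b qb /\ qb <= t - e, near_multiple e a b m & n%:R <= k%:R * (b - a)].
Proof.
elim: n e => [|n IH] e /andP[e0 et].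
  have [y [q [c tqt]]] := accum e0.
  have [[a [qa [m [ca qae nma]]]] [b [qb [m' [cb qbe nmb]]]]] := ancestors et c tqt.
  have nm := near_multipleD nma nmb.
  exists a, qa, b, qb, (m + m')%N; split=> //.
  by case: nm => _ _; apply: le_trans.
have fin : finite_set [set x | carries k x.1 x.2 /\ x.2 <= t - e].
  by apply: finite_closed; apply: finite_belowt; lra.
(* [d] bounds from below every positive shortfall [m * t - (b - a)] with [m <= k] and both ends
   carrying at most [t - e]. *)
have [d d0 hd] := finite_set_pos_lb
  (finite_image_pairs_ord k.+1 (fun x1 x2 m => m%:R * t - (x2.1 - x1.1)) fin).
pose e' := Num.min e (d / (2 * k%:R)).
have e'0 : 0 < e' by rewrite lt_min e0 divr_gt0// mulr_gt0.
have e'e : e' <= e by rewrite ge_min lexx.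
have e'd : k%:R * e' < d.
  have : e' <= d / (2 * k%:R) by rewrite ge_min lexx orbT.
  rewrite ler_pdivlMr ?mulr_gt0//; lra.
have [|a [qa [b [qb [m [[ca qae'] [cb qbe'] nm' nab]]]]]] := IH e'.
  by rewrite e'0; lra.
have nm := near_multiple_le e'e nm'.
have itv x qx : carries k x qx -> qx <= t - e' -> t - e < qx -> t - e < qx < t.
  by move=> *; apply/andP; split; lra.
(* Each enlargement of the bracket adds at least [1 / k], which raises [n] by one. *)
have width x z l : near_multiple e x z l -> 1 <= k%:R * (z - x).
  move=> h; have l0 := near_multiple_gt0 h; case: h => _ _; apply: le_trans.
  by rewrite ler1n.
have [qae|qae] := leP qa (t - e); last first.
  have [[a1 [qa1 [m1 [ca1 qa1e nm1]]]] _] := ancestors et ca (itv _ _ ca qae' qae).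
  have w1 := width _ _ _ nm1.
  have [qbe|qbe] := leP qb (t - e).
    exists a1, qa1, b, qb, (m1 + m)%N; split=> //; first exact: near_multipleD nm1 nm.
    by rewrite -natr1; lra.
  have [_ [b1 [qb1 [m2 [cb1 qb1e nm2]]]]] := ancestors et cb (itv _ _ cb qbe' qbe).
  have w2 := width _ _ _ nm2.
  exists a1, qa1, b1, qb1, (m1 + m + m2)%N; split=> //.
    exact: near_multipleD (near_multipleD nm1 nm) nm2.
  by rewrite -natr1; lra.
have [qbe|qbe] := leP qb (t - e); last first.
  have [_ [b1 [qb1 [m2 [cb1 qb1e nm2]]]]] := ancestors et cb (itv _ _ cb qbe' qbe).
  have w2 := width _ _ _ nm2.
  exists a, qa, b1, qb1, (m + m2)%N; split=> //; first exact: near_multipleD nm nm2.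
  by rewrite -natr1; lra.
(* If neither end moves, the shortfall is at least [d], yet at most [m * e' <= k * e' < d]. *)
case: nm' => h1 h2 h3.
have mk : (m <= k)%N.
  have ba1 : b - a <= 1.
    by have /andP[? ?] := carries_itv ca; have /andP[? ?] := carries_itv cb; lra.
  by rewrite -(ler_nat R); apply: le_trans h3 _; apply: ler_piMr ba1; exact: ltW.
have : d <= m%:R * t - (b - a).
  by apply: hd => //; exists ((a, qa), (b, qb), m).
have : m%:R * e' <= k%:R * e' by rewrite ler_wpM2r ?ler_nat// ltW.
by lra.
Qed.

Lemma no_accumulation : 0 < t -> False.
Proof.
move=> t0; have [|a [qa [b [qb [m [[ca _] [cb _] _]]]]]] := @wide_bracket k.+1 t.
  by rewrite t0 lexx.
have /andP[? ?] := carries_itv ca; have /andP[? ?] := carries_itv cb.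
have : k%:R * (b - a) <= k%:R * 1 by rewrite ler_wpM2l//; lra.
by rewrite -natr1; lra.
Qed.

End Accumulation.

(** * Finiteness below every threshold *)

(** At the supremum [s] of the good thresholds, the absence of accumulation makes [s] good, and
    [finite_gap] then passes beyond it. *)
Lemma finite_carries u : finite_set (below u).
Proof.
apply: contrapT => infu.
pose S := [set v | finite_set (below v)].
have sub v w : v <= w -> S w -> S v.
  by move=> vw; apply: sub_finite_set => -[y q] [/= c qv]; split=> //=; exact: lt_le_trans vw.
have Sk : S k%:R^-1 := finite_below0.
have hsS : has_sup S.
  split; first by exists k%:R^-1.
  by exists u => v Sv; rewrite leNgt; apply/negP => /ltW uv; exact/infu/(sub _ _ uv).
set s := sup S.
have s0 : 0 < s.
  by apply: lt_le_trans (ub_le_sup hsS.2 Sk); rewrite invr_gt0.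
have lts v : v < s -> S v.
  move=> vs; have sv : 0 < s - v by rewrite subr_gt0.
  have [w Sw] := sup_adherent sv hsS; rewrite subKr => /ltW vw.
  exact: sub vw Sw.
have : S s.
  apply: contrapT => nSs; apply: (@no_accumulation s) => // e e0.
  apply: contrapT => noq; apply/nSs.
  (* With no value in []s - e, s[], the pairs below [s] are already below [s - e / 2]; halving [e]
     covers the value [s - e] itself. *)
  have : S (s - e / 2) by apply: lts; lra.
  apply: sub_finite_set => -[y q] [/= c qs]; split=> //=.
  by rewrite ltNge; apply/negP => sq; apply: noq; exists y, q; split=> //; lra.
move=> /finite_gap[e e0 Se].
by have := ub_le_sup hsS.2 Se; rewrite -/s; lra.
Qed.

End Chains.

Theorem theorem4p3 (R : realType) (k : nat) (hk : (2 <= k)%N) :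
  finite_set (chain_set R k).
Proof.
have k_gt0 : (0 < k)%N by exact: leq_trans hk.
(* The threshold 2 exceeds every value, since [q <= r * q = y2 - y1 <= 1]. *)
have := finite_image fst (finite_carries k_gt0 (2 : R)).
apply: sub_finite_set => y [q c]; exists (y, q) => //; split=> //=.
case/(carries_inv k_gt0): c => [[-> _]|]; first by lra.
move=> [y1 [q1 [y2 [q2 [r [j [c1 c2 [y2E _ _ _ [kq j0 jr]]]]]]]]].
have /andP[? ?] := carries_itv k_gt0 c1; have /andP[? ?] := carries_itv k_gt0 c2.
have q0 : 0 < q by rewrite -(pmulr_rgt0 q (_ : 0 < k%:R)) ?ltr0n//; lra.
have : 1 * q <= r%:R * q by rewrite ler_wpM2r ?ler1n 1?ltW// (leq_trans _ jr).
by lra.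
Qed.
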